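(* Fix $\gamma>1$ and $B_0>0$. For any given $\theta_w\in(0,\frac\pi2)$ there exists a small constant $\varepsilon_0\in(0,1)$ depending on $(\gamma,B_0,\theta_w)$ such that if $(\rho_\infty,u_\infty)\in D_\infty(\gamma,B_0)$ satisfies $M_\infty\ge\frac1{\varepsilon_0}$, then $\theta_w<\theta_{\rm det}$, where $\theta_{\rm det}$ is the detachment angle of $(\rho_\infty,u_\infty)$.
   Context: $\mathfrak h(\rho)=\frac{\rho^{\gamma-1}}{\gamma-1}$; $D_\infty(\gamma,B_0)=\{(\rho_\infty,u_\infty)\in\mathbb R^2:\frac12u_\infty^2+\mathfrak h(\rho_\infty)=B_0,\ \rho_\infty>0,\ u_\infty>\rho_\infty^{(\gamma-1)/2}\}$; $M_\infty=u_\infty/\rho_\infty^{(\gamma-1)/2}$. Shock polar: for $(\rho_\infty,u_\infty)\in D_\infty(\gamma,B_0)$ put $\mathbf u_\infty=(u_\infty,0)$. There exist a unique $u_0\in(0,u_\infty)$ and a unique function $\mathfrak f_{\rm polar}\in C^0([u_0,u_\infty])\cap C^\infty((u_0,u_\infty))$, with $\mathfrak f_{\rm polar}(u_0)=\mathfrak f_{\rm polar}(u_\infty)=0$ and $\mathfrak f_{\rm polar}>0$ on $(u_0,u_\infty)$, such that for $u_0<u<u_\infty$ the vector $\mathbf u=(u,\mathfrak f_{\rm polar}(u))$ with $\rho=\mathfrak h^{-1}(B_0-\frac12|\mathbf u|^2)$ and $\boldsymbol\nu=\frac{\mathbf u_\infty-\mathbf u}{|\mathbf u_\infty-\mathbf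 u|}$ satisfies $$\rho\,\mathbf u\cdot\boldsymbol\nu=\rho_\infty\mathbf u_\infty\cdot\boldsymbol\nu,\qquad 0<\mathbf u\cdot\boldsymbol\nu<\mathbf u_\infty\cdot\boldsymbol\nu<\infty,$$ and any $(u,v)$ satisfying these two relations lies on $v=\mathfrak f_{\rm polar}(u)$ or $v=-\mathfrak f_{\rm polar}(u)$; moreover $\mathfrak f_{\rm polar}''<0$ on $(u_0,u_\infty)$. Detachment angle: $\theta_{\rm det}\in(0,\frac\pi2)$ is the unique constant such that the line $v=u\tan\theta$ intersects the curve $v=\mathfrak f_{\rm polar}(u)$ at two distinct points if $0\le\theta<\theta_{\rm det}$, at exactly one point if $\theta=\theta_{\rm det}$, and at no point if $\theta_{\rm det}<\theta<\frac\pi2$. *)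

(* Defs.v *)
From Stdlib Require Import Reals.
From Coquelicot Require Import Coquelicot.
Open Scope R_scope.

(* Rpower is only meaningful for positive bases; every use below has rho > 0. *)
Definition enthalpy (gamma rho : R) : R :=
  Rpower rho (gamma - 1) / (gamma - 1).

Definition sound_speed (gamma rho : R) : R := Rpower rho ((gamma - 1) / 2).

Definition D_infty (gamma B0 rho_inf u_inf : R) : Prop :=
  / 2 * u_inf ^ 2 + enthalpy gamma rho_inf = B0 /\
  0 < rho_inf /\
  sound_speed gamma rho_inf < u_inf.

Definition Mach (gamma rho_inf u_inf : R) : R :=
  u_inf / sound_speed gamma rho_inf.

Definition dot (a b : R * R) : R := fst a * fst b + snd a * snd b.

Definition norm2 (a : R * R) : R := sqrt (dot a a).

Definition vsub (a b : R * R) : R * R := (fst a - fst b, snd a - snd b).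

(* For a = b the divisions are by 0 and the value is junk; [shock_state]
   excludes this case through its strict inequality. *)
Definition unit_direction (a b : R * R) : R * R :=
  let d := vsub a b in (fst d / norm2 d, snd d / norm2 d).

(* The density rho = h^{-1}(B0 - |u|^2/2) is described as the positive solution
   of h(rho) = B0 - |u|^2/2: h is increasing on rho > 0, so there is at most
   one.  A vacuum state rho = 0 could not satisfy the mass balance. *)
Definition shock_state (gamma B0 rho_inf u_inf : R) (w : R * R) : Prop :=
  let w_inf := (u_inf, 0) in
  let nu := unit_direction w_inf w in
  exists rho : R,
    0 < rho /\
    enthalpy gamma rho = B0 - / 2 * (norm2 w) ^ 2 /\
    rho * dot w nu = rho_inf * dot w_inf nu /\
    0 < dot w nu /\ dot w nu < dot w_inf nu.

(* f is only meaningful on [u0, u_inf]; its values elsewhere are irrelevant. *)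
Definition is_shock_polar
    (gamma B0 rho_inf u_inf u0 : R) (f : R -> R) : Prop :=
  (0 < u0 < u_inf) /\
  continuous_on (fun u => u0 <= u <= u_inf) f /\
  (forall (n : nat) (u : R), u0 < u < u_inf -> ex_derive_n f n u) /\
  f u0 = 0 /\ f u_inf = 0 /\
  (forall u : R, u0 < u < u_inf -> 0 < f u) /\
  (forall u : R, u0 < u < u_inf ->
     shock_state gamma B0 rho_inf u_inf (u, f u)) /\
  (forall u v : R, shock_state gamma B0 rho_inf u_inf (u, v) ->
     (u0 <= u <= u_inf) /\ (v = f u \/ v = - f u)).

Definition line_meets_polar
    (u0 u_inf : R) (f : R -> R) (theta : R) (p : R * R) : Prop :=
  (u0 <= fst p <= u_inf) /\
  snd p = f (fst p) /\ snd p = fst p * tan theta.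

Definition exactly_two (S : R * R -> Prop) : Prop :=
  exists p q : R * R, p <> q /\ forall x : R * R, S x <-> (x = p \/ x = q).

Definition exactly_one (S : R * R -> Prop) : Prop :=
  exists p : R * R, forall x : R * R, S x <-> x = p.

Definition is_detachment_angle
    (u0 u_inf : R) (f : R -> R) (theta_det : R) : Prop :=
  (0 < theta_det < PI / 2) /\
  (forall theta : R, 0 <= theta < theta_det ->
     exactly_two (line_meets_polar u0 u_inf f theta)) /\
  exactly_one (line_meets_polar u0 u_inf f theta_det) /\
  (forall theta : R, theta_det < theta < PI / 2 ->
     forall p : R * R, ~ line_meets_polar u0 u_inf f theta p).

(* Main.v *)
Require Import Defs.
From Stdlib Require Import Reals Ranalysis5 Lra.
From Coquelicot Require Import Coquelicot.
Open Scope R_scope.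

(** The polar is the set of all states behind a shock, so every such state
    [(u, v)] with [0 < v] lies on its upper branch, and the line through the
    origin and [(u, v)] meets it.  The detachment angle is therefore at least
    [atan (v / u)] ([atan_slope_le_detachment]), and it suffices to exhibit one
    shock that turns the flow by more than [theta_w].

    Take a shock line inclined at the angle [atan T] to the incoming flow, and
    let [r > 1] be its compression ratio, the quotient of the densities behind
    and ahead.  The tangential velocity is kept and the normal one is divided
    by [r], which gives mass conservation and determines the state behind; its
    slope is [(r - 1) * T / (r + T ^ 2)].  What remains of Bernoulli's law is
    one scalar equation for [r],

      [h * (r ^ (gamma - 1) - 1) = E * (1 - 1 / r ^ 2)],

    where [h] is the incoming enthalpy and [E] the incoming normal kinetic
    energy ([oblique_shock_state]).  A large Mach number makes [h / E] small,
    which pushes a solution [r] beyond any prescribed bound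
    ([exists_strong_compression]).  Once [r >= T ^ 2] the slope is comparable
    to [T], and [T] may be chosen as large as [tan theta_w] requires.

    This works because gas with enthalpy law [h] can be compressed without
    limit: strong shocks turn the flow by angles tending to a right angle. *)

(** * The detachment angle and the slopes of shock states *)

(** A line steeper than the detachment angle would miss the polar, whereas the
    one through a given shock state does not. *)
Lemma atan_slope_le_detachment (gamma B0 rho_inf u_inf u0 : R) (f : R -> R)
    (theta_det u v : R) :
  is_shock_polar gamma B0 rho_inf u_inf u0 f ->
  is_detachment_angle u0 u_inf f theta_det ->
  shock_state gamma B0 rho_inf u_inf (u, v) -> 0 < v ->
  atan (v / u) <= theta_det.
Proof.
intros [[Hu0 _] [_ [_ [f0 [f1 [fpos [_ Hall]]]]]]] [_ [_ [_ Hnone]]] Hs Hv.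
destruct (Hall u v Hs) as [Hu Hvf].
assert (Hf : 0 <= f u).
{ destruct (Req_dec u u0) as [-> | n0]; [lra |].
  destruct (Req_dec u u_inf) as [-> | n1]; [lra |].
  apply Rlt_le, fpos; lra. }
apply Rnot_lt_le; intros Hlt.
apply (Hnone (atan (v / u))) with (p := (u, v)).
- split; [exact Hlt | apply atan_bound].
- repeat split; simpl; try lra.
  rewrite tan_atan; field; lra.
Qed.

(** * States behind an oblique shock *)

Lemma enthalpy_sound_speed (gamma rho : R) :
  enthalpy gamma rho = sound_speed gamma rho ^ 2 / (gamma - 1).
Proof.
unfold enthalpy, sound_speed; f_equal.
simpl; rewrite Rmult_1_r, <- Rpower_plus; f_equal; field.
Qed.

Lemma enthalpy_mult (gamma r rho : R) :
  0 < r -> 0 < rho ->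
  enthalpy gamma (r * rho) = Rpower r (gamma - 1) * enthalpy gamma rho.
Proof.
intros Hr Hrho; unfold enthalpy, Rdiv.
rewrite <- Rpower_mult_distr by assumption; ring.
Qed.

(** With [s = sqrt (1 + T ^ 2)], the unit vectors normal and tangential to the
    shock are [(T, -1) / s] and [(1, T) / s].  The incoming velocity has
    components [u_inf * T / s] and [u_inf / s] along them; the state below
    results from dividing the first component by [r].  Mass is conserved since
    the density is multiplied by [r], and the hypothesis on [r] is Bernoulli's
    law with the common tangential energy cancelled. *)
Lemma oblique_shock_state (gamma B0 rho_inf u_inf r T : R) :
  0 < rho_inf -> 0 < u_inf -> 1 < r -> 0 < T ->
  / 2 * u_inf ^ 2 + enthalpy gamma rho_inf = B0 ->
  enthalpy gamma rho_inf * (Rpower r (gamma - 1) - 1) =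
    / 2 * u_inf ^ 2 * (T ^ 2 / (1 + T ^ 2)) * (1 - / r ^ 2) ->
  shock_state gamma B0 rho_inf u_inf
    (u_inf * (1 + T ^ 2 / r) / (1 + T ^ 2),
     u_inf * (1 - / r) * T / (1 + T ^ 2)).
Proof.
intros Hrho Hu Hr HT HB Heq.
pose (s := sqrt (1 + T ^ 2)).
assert (HT2 : 0 < T ^ 2) by (apply pow_lt; lra).
assert (Hs : 0 < s) by (apply sqrt_lt_R0; lra).
assert (Hss : s * s = 1 + T ^ 2) by (apply sqrt_sqrt; lra).
assert (Hr1 : 0 < 1 - / r).
{ rewrite <- Rinv_1; apply Rlt_0_minus, Rinv_lt_contravar; lra. }
set (w := (u_inf * (1 + T ^ 2 / r) / (1 + T ^ 2),
           u_inf * (1 - / r) * T / (1 + T ^ 2))).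
assert (Hd : norm2 (vsub (u_inf, 0) w) = u_inf * (1 - / r) * T / s).
{ unfold norm2, dot, vsub, w; cbn [fst snd].
  apply sqrt_lem_1.
  - apply Rplus_le_le_0_compat; apply Rle_0_sqr.
  - apply Rlt_le, Rdiv_lt_0_compat; [| exact Hs].
    repeat apply Rmult_lt_0_compat; lra.
  - transitivity ((u_inf * (1 - / r) * T) ^ 2 / (s * s)); [field; lra |].
    rewrite Hss; field; lra. }
assert (Hnu : unit_direction (u_inf, 0) w = (T / s, - / s)).
{ unfold unit_direction; rewrite Hd; unfold vsub, w; cbn [fst snd].
  rewrite <- Hss; f_equal.
  - replace (u_inf - u_inf * (1 + T ^ 2 / r) / (s * s))
      with (u_inf * (s * s - 1 - T ^ 2 / r) / (s * s)) by (field; lra).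
    rewrite Hss at 1; field; repeat split; lra.
  - field; repeat split; lra. }
assert (Hw : dot w (T / s, - / s) = u_inf * T / s * / r).
{ unfold dot, w; cbn [fst snd]; field; repeat split; lra. }
assert (Hwi : dot (u_inf, 0) (T / s, - / s) = u_inf * T / s).
{ unfold dot; cbn [fst snd]; field; lra. }
assert (Hn : 0 < u_inf * T / s).
{ apply Rdiv_lt_0_compat; [apply Rmult_lt_0_compat |]; assumption. }
unfold shock_state; rewrite Hnu, Hw, Hwi.
exists (r * rho_inf); repeat split.
- apply Rmult_lt_0_compat; lra.
- rewrite enthalpy_mult by lra.
  unfold norm2; rewrite pow2_sqrt
    by (apply Rplus_le_le_0_compat; apply Rle_0_sqr).
  replace (Rpower r (gamma - 1) * enthalpy gamma rho_inf)
    with (enthalpy gamma rho_inf * (Rpower r (gamma - 1) - 1)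
          + enthalpy gamma rho_inf) by ring.
  rewrite Heq, <- HB; unfold dot, w; cbn [fst snd]; field; lra.
- field; lra.
- apply Rmult_lt_0_compat; [exact Hn | apply Rinv_0_lt_compat; lra].
- nra.
Qed.

(** * Existence of strong shocks *)

(** At [r0] the left-hand side is still the smaller one; it is unbounded in
    [r] while the right-hand side stays below [E], so that the two cross
    beyond [r0]. *)
Lemma exists_strong_compression (a h E r0 : R) :
  0 < a -> 0 < h -> 0 < E -> 1 < r0 ->
  h * (Rpower r0 a - 1) < E * (1 - / r0 ^ 2) ->
  exists r, r0 <= r /\ h * (Rpower r a - 1) = E * (1 - / r ^ 2).
Proof.
intros Ha Hh HE Hr0 Hlt.
assert (HEh : 0 < E / h) by (apply Rdiv_lt_0_compat; assumption).
(* Here the left-hand side equals the supremum of the right-hand side. *)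
pose (r1 := Rpower (1 + E / h) (/ a)).
assert (Hr1 : Rpower r1 a = 1 + E / h).
{ unfold r1; rewrite Rpower_mult, Rinv_l by lra; apply Rpower_1; lra. }
assert (Hr1pos : 0 < r1) by apply exp_pos.
assert (Hl1 : h * (Rpower r1 a - 1) = E) by (rewrite Hr1; field; lra).
assert (Hinv : forall r, 0 < r -> 0 < / r ^ 2).
{ intros r Hr; apply Rinv_0_lt_compat, pow_lt, Hr. }
assert (Hr01 : r0 < r1).
{ apply Rnot_le_lt; intros Hle.
  assert (Rpower r1 a <= Rpower r0 a) by (apply Rle_Rpower_l; lra).
  specialize (Hinv r0 ltac:(lra)); nra. }
destruct (IVT_interv
  (fun r => h * (Rpower r a - 1) - E * (1 - / r ^ 2)) r0 r1)
  as [r [Hr Hz]].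
- intros r Hr; apply derivable_continuous_pt, ex_derive_Reals_0.
  unfold Rpower; auto_derive; repeat split; try lra.
  apply Rgt_not_eq, Rmult_lt_0_compat; lra.
- exact Hr01.
- lra.
- rewrite Hl1; specialize (Hinv r1 Hr1pos); nra.
- exists r; split; lra.
Qed.

(** The threshold on the Mach number makes the enthalpy cost of the
    compression [T ^ 2] less than a quarter of [u_inf ^ 2], which is at most the
    kinetic energy that such a shock releases when [T >= 2]. *)
Lemma high_Mach_compression (gamma rho_inf u_inf T : R) :
  1 < gamma -> sound_speed gamma rho_inf < u_inf -> 2 <= T ->
  2 + 4 * Rpower (T ^ 2) (gamma - 1) / (gamma - 1) <= Mach gamma rho_inf u_inf ->
  exists r, T ^ 2 <= r /\
    enthalpy gamma rho_inf * (Rpower r (gamma - 1) - 1) =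
      / 2 * u_inf ^ 2 * (T ^ 2 / (1 + T ^ 2)) * (1 - / r ^ 2).
Proof.
intros Hg Hsup HT HM.
rewrite enthalpy_sound_speed.
unfold Mach in HM.
set (c := sound_speed gamma rho_inf) in *.
assert (Hc : 0 < c) by apply exp_pos.
set (P := Rpower (T ^ 2) (gamma - 1)) in *.
assert (HP : 0 < P) by apply exp_pos.
assert (HT2 : 4 <= T ^ 2) by nra.
assert (Hu2 : 0 < u_inf ^ 2) by (apply pow_lt; lra).
assert (HS : 4 / 5 <= T ^ 2 / (1 + T ^ 2)).
{ apply Rmult_le_reg_r with (1 + T ^ 2); [lra |].
  unfold Rdiv at 2; rewrite Rmult_assoc, Rinv_l; lra. }
apply exists_strong_compression.
- lra.
- apply Rdiv_lt_0_compat; [apply pow_lt; exact Hc | lra].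
- apply Rmult_lt_0_compat; lra.
- lra.
- fold P.
  set (q := P / (gamma - 1)).
  assert (Hq : 0 < q) by (apply Rdiv_lt_0_compat; lra).
  assert (HMq : (2 + 4 * q) * c <= u_inf).
  { apply Rmult_le_reg_r with (/ c); [apply Rinv_0_lt_compat, Hc |].
    rewrite Rmult_assoc, Rinv_r, Rmult_1_r by lra.
    unfold q; unfold Rdiv in *; lra. }
  assert (Hcost : 4 * (c ^ 2 * q) < u_inf ^ 2).
  { assert (((2 + 4 * q) * c) ^ 2 <= u_inf ^ 2)
      by (apply pow_incr; split; [apply Rmult_le_pos |]; lra).
    assert (0 < c ^ 2) by (apply pow_lt, Hc).
    nra. }
  assert (Hlhs : c ^ 2 / (gamma - 1) * (P - 1) <= c ^ 2 * q).
  { assert (0 < c ^ 2 / (gamma - 1))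
      by (apply Rdiv_lt_0_compat; [apply pow_lt, Hc | lra]).
    replace (c ^ 2 * q) with (c ^ 2 / (gamma - 1) * P)
      by (unfold q; field; lra).
    nra. }
  assert (Hi : / (T ^ 2) ^ 2 <= / 16) by (apply Rinv_le_contravar; nra).
  assert (/ 2 <= T ^ 2 / (1 + T ^ 2) * (1 - / (T ^ 2) ^ 2)) by nra.
  rewrite Rmult_assoc; nra.
Qed.

(** * Large detachment angles *)

Theorem lemma2p5 :
  forall gamma B0 : R, 1 < gamma -> 0 < B0 ->
  forall theta_w : R, 0 < theta_w < PI / 2 ->
  exists eps0 : R, 0 < eps0 < 1 /\
    forall rho_inf u_inf : R,
      D_infty gamma B0 rho_inf u_inf ->
      / eps0 <= Mach gamma rho_inf u_inf ->
      forall (u0 : R) (f_polar : R -> R) (theta_det : R),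
        is_shock_polar gamma B0 rho_inf u_inf u0 f_polar ->
        is_detachment_angle u0 u_inf f_polar theta_det ->
        theta_w < theta_det.
Proof.
intros gamma B0 Hg _ theta_w Hth.
assert (Htan : 0 < tan theta_w) by (apply tan_gt_0; lra).
(* With r >= T ^ 2 >= 4 the slope (r - 1) T / (r + T ^ 2) is at least 3 T / 8. *)
pose (T := 4 * (tan theta_w + 1)).
pose (A := 2 + 4 * Rpower (T ^ 2) (gamma - 1) / (gamma - 1)).
assert (HA : 2 < A).
{ assert (0 < 4 * Rpower (T ^ 2) (gamma - 1) / (gamma - 1)).
  { apply Rdiv_lt_0_compat; [| lra].
    apply Rmult_lt_0_compat; [lra | apply exp_pos]. }
  unfold A; lra. }
exists (/ A); split.
{ split; [apply Rinv_0_lt_compat; lra |].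
  rewrite <- Rinv_1; apply Rinv_lt_contravar; lra. }
intros rho_inf u_inf [HB [Hrho Hsup]] HM u0 f theta_det Hpolar Hdet.
rewrite Rinv_inv in HM.
assert (HT : 4 <= T) by (unfold T; lra).
destruct (high_Mach_compression gamma rho_inf u_inf T) as [r [Hr Heq]];
  [assumption | assumption | lra | exact HM |].
assert (Hu : 0 < u_inf).
{ apply Rlt_trans with (2 := Hsup), exp_pos. }
assert (Hr4 : 4 <= r) by nra.
assert (HT2 : 0 < T ^ 2) by nra.
pose proof (oblique_shock_state gamma B0 rho_inf u_inf r T Hrho Hu
  ltac:(lra) ltac:(lra) HB Heq) as Hshock.
assert (Hri : / r <= / 4) by (apply Rinv_le_contravar; lra).
eapply Rlt_le_trans;
  [| apply (atan_slope_le_detachment _ _ _ _ _ _ _ _ _ Hpolar Hdet Hshock)].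
- rewrite <- (atan_tan theta_w) by lra.
  apply atan_increasing.
  replace (u_inf * (1 - / r) * T / (1 + T ^ 2)
           / (u_inf * (1 + T ^ 2 / r) / (1 + T ^ 2)))
    with ((r - 1) * T / (r + T ^ 2)) by (field; repeat split; nra).
  apply Rmult_lt_reg_r with (r + T ^ 2); [lra |].
  unfold Rdiv; rewrite Rmult_assoc, Rinv_l, Rmult_1_r by lra.
  apply Rle_lt_trans with (tan theta_w * (2 * r)); [nra |].
  unfold T; nra.
- apply Rdiv_lt_0_compat; [| lra].
  repeat apply Rmult_lt_0_compat; lra.
Qed.
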